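(* Let $z, c \ge 0$ and let $\psi \in \mathcal{I}_c^\infty$. The decision rule $\delta^*$ that solves the inner minimization (the minimization over decision policies $\delta$) in $$\inf_{\psi \in \mathcal{I}_c^\infty}\ \inf_{\delta}\ \alpha(\psi,\delta) + z\,\beta(\psi,\delta)$$ is a likelihood ratio test of the form $$\delta_t^*(\boldsymbol{x}_t) \begin{cases} = 0, & z \prod_{n=1}^t \frac{p_1(x_n)}{p_0(x_n)} < 1,\\ \in [0,1], & z \prod_{n=1}^t \frac{p_1(x_n)}{p_0(x_n)} = 1,\\ = 1, & z \prod_{n=1}^t \frac{p_1(x_n)}{p_0(x_n)} > 1.\end{cases}$$ Moreover, it holds that $$\alpha(\psi,\delta^* ) + z\,\beta(\psi,\delta^* ) = \mathbb{E}_{0,\psi}\Biggl[g\biggl(z\prod_{t=1}^T \frac{p_1(X_t)}{p_0(X_t)}\biggr)\Biggr].$$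
   Context: $(\mathcal{X},\mathcal{F})$ is a measurable space, $\boldsymbol{X} = (X_1,X_2,\ldots)$ a random sequence in $\mathcal{X}$, $\boldsymbol{X}_t=(X_1,\ldots,X_t)$, $\boldsymbol{x}_t=(x_1,\ldots,x_t)$. Under hypothesis $\mathcal{H}_i$, $i\in\{0,1\}$, $\boldsymbol{X}$ is i.i.d. according to $P_i$. Standing assumptions: $P_1$ is absolutely continuous with respect to $P_0$, and $D_{\mathrm{KL}}(P_0\Vert P_1)$ is non-zero and finite; $p_0,p_1$ are the densities of $P_0,P_1$ with respect to a suitable background measure. Define $g:\mathbb{R}_{\ge 0}\to[0,1]$, $g(z)=\min\{1,z\}$; empty products equal $1$. A stopping policy is a sequence $\psi=(\psi_0,\psi_1,\ldots)$ of (measurable) functions $\psi_t=\psi_t(\boldsymbol{x}_t)\in[0,1]$ ($\psi_0$ a constant), where $\psi_t(\boldsymbol{x}_t)$ is the probability of stopping at time $t$ given that the test has not stopped before and $\boldsymbol{x}_t$ has been observed. $T$ is the resulting stopping time, with $\mathbb{P}[T=t\mid\boldsymbol{X}_t=\boldsymbol{x}_t]=\psi_t(\boldsymbol{x}_t)\prod_{n=0}^{t-1}(1-\psi_n(\boldsymbol{x}_n))$. A decision policy is a sequence $\delta=(\delta_0,\delta_1,\ldots)$ of (measurable) functions $\delta_t=\delta_t(\boldsymbol{x}_t)\in[0,1]$; upon stopping at $T=t$ the test outputs $D\in\{0,1\}$ ($D=i$ means acceptance of $\mathcal{H}_i$) with $\delta_t(\boldsymbol{x}_t)=\mathbb{E}[D\mid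 T=t,\boldsymbol{X}_t=\boldsymbol{x}_t]$. $\mathbb{E}_{i,\psi,\delta}$ is expectation under $\mathcal{H}_i$ with policies $\psi,\delta$ (subscripts are dropped when irrelevant). The error probabilities are $\alpha(\psi,\delta)=\mathbb{E}_{0,\psi,\delta}[D]$ and $\beta(\psi,\delta)=\mathbb{E}_{1,\psi,\delta}[1-D]$. $\mathcal{I}_c^\infty$ is the set of stopping policies $\psi$ with $\mathbb{E}_{\mathbf{P},\psi}[T]\le c$ for every probability measure $\mathbf{P}$ on $\mathcal{X}^\infty$ (as distribution of $\boldsymbol{X}$). *)

(* Defs.v *)
From HB Require Import structures.
From mathcomp Require Import all_boot all_order all_algebra.
From mathcomp Require Import all_classical all_reals all_analysis.
From mathcomp Require Import measurable_realfun.

Set Implicit Arguments.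
Unset Strict Implicit.
Unset Printing Implicit Defensive.
Import Order.TTheory GRing.Theory Num.Theory.
Import numFieldNormedType.Exports.
Local Open Scope classical_set_scope.
Local Open Scope ring_scope.

Section sequence_space.
Context d (X : measurableType d).

Definition cylinder : set_system (nat -> X) :=
  \bigcup_n preimage_set_system [set: nat -> X] (fun x => x n) measurable.

(* The product sigma-algebra on sequences.  Indices start at 0: [x n] is the
   (n+1)-st observation. *)
Definition seqspace := g_sigma_algebraType cylinder.

Definition history (t : nat) (x : seqspace) : t.-tuple X :=
  [tuple x i | i < t].

Lemma measurable_coord n : measurable_fun [set: seqspace] (fun x => x n).
Proof.
move=> _ B mB; apply: sub_sigma_algebra; exists n => //.
by exists B.
Qed.

Lemma measurable_history t : measurable_fun [set: seqspace] (history t).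
Proof.
apply/measurable_fun_tnthP => i.
rewrite (_ : _ \o _ = fun x : seqspace => x i); first exact: measurable_coord.
by apply/funext => x /=; rewrite tnth_mktuple.
Qed.

End sequence_space.

(* A stopping time is a value of [option nat], with [None] for "never". *)
HB.instance Definition _ := @isMeasurable.Build default_measure_display
  (option nat) discrete_measurable discrete_measurable0
  discrete_measurableC discrete_measurableU.

Section policy.
Context d (X : measurableType d) (R : realType).

(* Both stopping and decision policies are of this form. *)
Record policy := Policy {
  policy_fun :> forall t, t.-tuple X -> R ;
  measurable_policy : forall t,
    measurable_fun [set: t.-tuple X] (@policy_fun t) ;
  policy_itv : forall t (x : t.-tuple X), 0 <= policy_fun x <= 1 }.

Implicit Types (psi delta : policy) (x : seqspace X).

(* Conditional probability, given the observations, of not stopping before t. *)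
Definition survival psi t x : R := \prod_(n < t) (1 - psi n (history n x)).

Definition stop_prob psi t x : R := psi t (history t x) * survival psi t x.

Definition never_prob psi x : R := limn (survival psi ^~ x).

Definition stop_weight psi (o : option nat) x : R :=
  if o is Some t then stop_prob psi t x else never_prob psi x.

Lemma survivalS psi t x :
  survival psi t.+1 x = survival psi t x * (1 - psi t (history t x)).
Proof. by rewrite /survival big_ord_recr. Qed.

Lemma survival_ge0 psi t x : 0 <= survival psi t x.
Proof.
apply: prodr_ge0 => n _; rewrite subr_ge0.
by have /andP[] := policy_itv psi (history n x).
Qed.

Lemma survival_le psi t x : survival psi t.+1 x <= survival psi t x.
Proof.
rewrite survivalS ler_piMr ?survival_ge0// gerBl.
by have /andP[] := policy_itv psi (history t x).
Qed.

Lemma is_cvg_survival psi x : cvgn (survival psi ^~ x).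
Proof.
apply: nonincreasing_is_cvgn.
  by apply/nonincreasing_seqP => t; exact: survival_le.
by exists 0 => _ [t _ <-]; exact: survival_ge0.
Qed.

Lemma sum_stop_prob psi t x :
  \sum_(0 <= n < t) stop_prob psi n x = 1 - survival psi t x.
Proof.
elim: t => [|t IH]; first by rewrite big_nil /survival big_ord0 subrr.
rewrite big_nat_recr//= IH survivalS /stop_prob mulrBr mulr1 [psi _ _ * _]mulrC.
by rewrite opprB addrA addrAC.
Qed.

Lemma stop_weight_ge0 psi o x : 0 <= stop_weight psi o x.
Proof.
case: o => [t|] /=.
  rewrite mulr_ge0 ?survival_ge0//.
  by have /andP[] := policy_itv psi (history t x).
apply: limr_ge; first exact: is_cvg_survival.
by apply: nearW => t; exact: survival_ge0.
Qed.

Lemma measurable_policy_history psi t :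
  measurable_fun [set: seqspace X] (fun x => psi t (history t x)).
Proof.
apply: (measurableT_comp (@measurable_policy psi t)).
exact: measurable_history.
Qed.

Lemma measurable_survival psi t :
  measurable_fun [set: seqspace X] (survival psi t).
Proof.
apply: measurable_prod => n _; apply: measurable_funB => //.
exact: measurable_policy_history.
Qed.

Lemma measurable_stop_weight psi o :
  measurable_fun [set: seqspace X] (stop_weight psi o).
Proof.
case: o => [t|] /=.
  apply: measurable_funM; last exact: measurable_survival.
  exact: measurable_policy_history.
apply: (@measurable_fun_cvg _ _ _ _ (survival psi)).
  by move=> t; exact: measurable_survival.
by move=> x _; exact: is_cvg_survival.
Qed.

End policy.

Section stop_kernel.
Context d (X : measurableType d) (R : realType) (psi : policy X R).
Local Open Scope ereal_scope.

Definition kstop_at (o : option nat) (x : seqspace X) :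
    {measure set (option nat) -> \bar R} :=
  mscale (NngNum (stop_weight_ge0 psi o x)) (dirac o).

Let measurable_kstop_at o U : measurable U ->
  measurable_fun [set: seqspace X] (kstop_at o ^~ U).
Proof.
move=> mU; rewrite /kstop_at /= /mscale /=.
apply: emeasurable_funM => //; apply/measurable_EFinP.
exact: measurable_stop_weight.
Qed.

HB.instance Definition _ o :=
  isKernel.Build _ _ _ _ _ (kstop_at o) (measurable_kstop_at o).

(* Conditional law of the stopping time given the observations. *)
Definition stop_kernel : seqspace X -> {measure set (option nat) -> \bar R} :=
  kadd (kseries (fun t => kstop_at (Some t))) (kstop_at None).

HB.instance Definition _ := Kernel.on stop_kernel.

Lemma stop_kernelE x A : stop_kernel x A =
  \sum_(0 <= t <oo) (stop_prob psi t x)%:E * \d_(Some t) A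
  + (never_prob psi x)%:E * \d_None A.
Proof.
exact: (measure_addE (kseries (fun t => kstop_at (Some t)) x)
                     (kstop_at None x) A).
Qed.

Let stop_kernel_prob x : stop_kernel x [set: _] = 1.
Proof.
rewrite stop_kernelE diracT mule1.
under eq_eseriesr do rewrite diracT mule1.
suff -> : \sum_(0 <= t <oo) (stop_prob psi t x)%:E = (1 - never_prob psi x)%:E.
  by rewrite -EFinD subrK.
apply/cvg_lim => //.
rewrite (_ : (fun _ => _) = EFin \o (fun t => 1 - survival psi t x)%R);
  last first.
  by apply/funext => t /=; rewrite sumEFin sum_stop_prob.
apply: cvg_EFin; first exact: nearW.
by apply: cvgB; [exact: cvg_cst|exact: is_cvg_survival].
Qed.

HB.instance Definition _ :=
  Kernel_isProbability.Build _ _ _ _ _ stop_kernel stop_kernel_prob.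

End stop_kernel.

Section decision_kernel.
Context d (X : measurableType d) (R : realType) (delta : policy X R).

(* Conditional probability of D = 1 given the observations and the stopping
   time.  The test outputs no decision if it never stops; D is then set to 0,
   which is immaterial for the policies that stop almost surely. *)
Definition decision_prob (w : seqspace X * option nat) : R :=
  if w.2 is Some t then delta t (history t w.1) else 0.

Lemma measurable_decision_prob :
  measurable_fun [set: seqspace X * option nat] decision_prob.
Proof.
move=> _ B mB; rewrite setTI.
rewrite (_ : _ @^-1` B =
    \bigcup_t ([set x | B (delta t (history t x))] `*` [set Some t])
    `|` [set _ | B 0] `*` [set None]); last first.
  apply/seteqP.
  split => [[x [t|]] /= Bx|[x o] /= [[t _ /= [Bx ->]]|[B0 ->]]] //.
    by left; exists t.
  by right.
apply: measurableU.
  apply: bigcupT_measurable => t; apply: measurableX => //.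
  rewrite -[X in measurable X]setTI.
  exact: measurable_policy_history.
apply: measurableX => //.
have [B0|B0] := pselect (B 0).
  rewrite (_ : [set _ | _] = setT); first exact: measurableT.
  by apply/seteqP; split.
rewrite (_ : [set _ | _] = set0); first exact: measurable0.
by apply/seteqP; split.
Qed.

Definition decision_kernel :
    seqspace X * option nat -> {measure set bool -> \bar R} :=
  kprobability (measurableT_comp measurable_bernoulli_prob
                                 measurable_decision_prob).

HB.instance Definition _ := ProbabilityKernel.on decision_kernel.

End decision_kernel.

Section joint_law.
Context d d' (S : measurableType d) (T : measurableType d') (R : realType).
Variables (P : probability S R) (k : R.-pker S ~> T).
Local Open Scope ereal_scope.

(* Joint law of a P-distributed s and of a k(s)-distributed t. *)
Definition joint_law (A : set (S * T)) : \bar R := \int[P]_s k s (xsection A s).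

Let joint_law0 : joint_law set0 = 0.
Proof. by apply: integral0_eq => s _; rewrite xsection0 measure0. Qed.

Let joint_law_ge0 A : 0 <= joint_law A.
Proof. exact: integral_ge0. Qed.

Let joint_law_sigma_additive : semi_sigma_additive joint_law.
Proof.
move=> A mA tA mUA.
rewrite [X in _ --> X](_ : _ =
    \sum_(0 <= i <oo) \int[P]_s k s (xsection (A i) s)); last first.
  rewrite -integral_nneseries//; last first.
    by move=> n; apply: measurable_fun_xsection_finite_kernel; rewrite inE.
  apply: eq_integral => s _; rewrite xsection_bigcup.
  rewrite measure_bigcup//.
  - by apply: eq_eseriesl => n; rewrite in_setT.
  - by move=> n _; exact: measurable_xsection.
  - exact: trivIset_xsection.
by apply: is_cvg_nneseries => n _ _; exact: integral_ge0.
Qed.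

HB.instance Definition _ := isMeasure.Build _ _ _ joint_law
  joint_law0 joint_law_ge0 joint_law_sigma_additive.

Let joint_law_setT : joint_law [set: _] = 1.
Proof.
rewrite /joint_law; under eq_integral => s _.
  rewrite (_ : xsection _ _ = setT) ?prob_kernel; last first.
    by apply/seteqP; split => // t _; rewrite /xsection/= in_setT.
  over.
rewrite integral_cst// mul1e; exact: probability_setT.
Qed.

HB.instance Definition _ :=
  Measure_isProbability.Build _ _ _ joint_law joint_law_setT.

End joint_law.

Section sequential_test.
Context d (X : measurableType d) (R : realType).
Local Open Scope ereal_scope.
Implicit Types (Q : probability (seqspace X) R) (psi delta : policy X R).

(* Law of (observations, stopping time). *)
Definition stop_law Q psi : probability (seqspace X * option nat)%type R :=
  joint_law Q (stop_kernel psi).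

(* Law of ((observations, stopping time), decision). *)
Definition test_law Q psi delta :
    probability (seqspace X * option nat * bool)%type R :=
  joint_law (stop_law Q psi) (decision_kernel delta).

(* P[T = t | X_t] = psi_t(X_t) * \prod_(n < t) (1 - psi_n(X_n)) *)
Lemma stop_law_cond Q psi t (B : set (t.-tuple X)) : measurable B ->
  stop_law Q psi [set w | w.2 = Some t /\ B (history t w.1)] =
  \int[Q]_(x in history t @^-1` B) (stop_prob psi t x)%:E.
Proof.
move=> mB; rewrite [RHS]integral_mkcond; apply: eq_integral => x _ /=.
rewrite stop_kernelE patchE.
have -> : xsection [set w | w.2 = Some t /\ B (history t w.1)] x =
    [set o | o = Some t /\ B (history t x)].
  by apply/seteqP; split => o; rewrite /xsection /= inE.
rewrite [in X in _ + X]diracE memNset ?mule0 ?adde0; last by case.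
rewrite (@nneseriesD1 _ _ t)//; last first.
  move=> n _; apply: mule_ge0 => //.
  by rewrite lee_fin (stop_weight_ge0 psi (Some n)).
rewrite eseries0 ?adde0 => [|n _ nt]; last first.
  by rewrite diracE memNset ?mule0// => -[[tn]]; rewrite tn eqxx in nt.
case: ifPn => [|xB].
  by rewrite inE/= => xB; rewrite diracE mem_set ?mule1.
by rewrite diracE memNset ?mule0// => -[_ Bx]; rewrite mem_set in xB.
Qed.

(* E[D | T = t, X_t] = delta_t(X_t) *)
Lemma test_law_cond Q psi delta t (B : set (t.-tuple X)) : measurable B ->
  test_law Q psi delta
    [set w | [/\ w.2 = true, w.1.2 = Some t & B (history t w.1.1)]] =
  \int[stop_law Q psi]_(w in [set w | w.2 = Some t /\ B (history t w.1)])
    (delta t (history t w.1))%:E.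
Proof.
move=> mB; rewrite [RHS]integral_mkcond; apply: eq_integral => -[x o] _ /=.
rewrite patchE.
have -> : xsection
    [set w | [/\ w.2 = true, w.1.2 = Some t & B (history t w.1.1)]] (x, o) =
  [set b : bool | [/\ b = true, o = Some t & B (history t x)]].
  by apply/seteqP; split => b; rewrite /xsection /= inE.
case: ifPn => [|xB].
  rewrite inE/= => -[-> xB].
  rewrite [LHS]bernoulli_probE ?policy_itv//.
  rewrite /dirac !indicE mem_set// memNset ?mule0 ?adde0 ?mule1//; by case.
rewrite (_ : [set b | _] = set0) ?measure0//.
by apply/seteqP; split => // b [_ ot Bx]; rewrite mem_set in xB.
Qed.

Definition stopping_time (w : seqspace X * option nat) : \bar R :=
  if w.2 is Some t then t%:R%:E else +oo.

Definition decision (w : seqspace X * option nat * bool) : R := w.2%:R.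

(* The set I_c^oo. *)
Definition uniformly_bounded_stopping (c : R) psi :=
  forall Q, \int[stop_law Q psi]_w stopping_time w <= c%:E.

Definition type1_error Q0 psi delta : \bar R :=
  'E_(test_law Q0 psi delta)[decision].

Definition type2_error Q1 psi delta : \bar R :=
  'E_(test_law Q1 psi delta)[fun w => 1 - decision w]%R.

Definition weighted_error (z : R) Q0 Q1 psi delta : \bar R :=
  type1_error Q0 psi delta + z%:E * type2_error Q1 psi delta.

Definition optimal_decision (z : R) Q0 Q1 psi delta :=
  forall delta', weighted_error z Q0 Q1 psi delta <=
                 weighted_error z Q0 Q1 psi delta'.

End sequential_test.

Section likelihood.
Context d (X : measurableType d) (R : realType).
Local Open Scope ereal_scope.
Implicit Types (P : probability X R) (p : X -> R).

Definition is_density (mu : {measure set X -> \bar R}) P p :=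
  [/\ measurable_fun [set: X] p, forall x, (0 <= p x)%R &
      forall A, measurable A -> P A = \int[mu]_(x in A) (p x)%:E].

(* The integrand is +oo where p0 > 0 = p1. *)
Definition KL_divergence P0 (p0 p1 : X -> R) : \bar R :=
  \int[P0]_x lne ((p0 x)%:E / (p1 x)%:E).

Definition iid_law P (Q : probability (seqspace X) R) :=
  forall t (A : 'I_t -> set X), (forall i, measurable (A i)) ->
    Q [set x : seqspace X | forall i : 'I_t, A i (x i)] = \prod_(i < t) P (A i).

Local Close Scope ereal_scope.

Definition likelihood_ratio (p0 p1 : X -> R) t (x : t.-tuple X) : R :=
  \prod_(i < t) (p1 (tnth x i) / p0 (tnth x i)).

(* The constraint bears only on the points where the ratio is defined; the
   others form a null set under both hypotheses, whatever value is assigned to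
   p1 / 0. *)
Definition lrt_at (z : R) (p0 p1 : X -> R) (delta : policy X R)
    t (x : t.-tuple X) : Prop :=
  (forall i, p0 (tnth x i) != 0) ->
  [/\ z * likelihood_ratio p0 p1 x < 1 -> delta t x = 0,
      z * likelihood_ratio p0 p1 x = 1 -> 0 <= delta t x <= 1 &
      z * likelihood_ratio p0 p1 x > 1 -> delta t x = 1].

Definition is_lrt (z : R) p0 p1 delta :=
  forall t (x : t.-tuple X), lrt_at z p0 p1 delta x.

(* The form holds at the stopping time, almost surely under H_0 (hence under
   H_1).  A minimizer is determined only up to such null sets. *)
Definition ae_lrt (z : R) p0 p1 (Q0 : probability (seqspace X) R)
    (psi delta : policy X R) :=
  {ae stop_law Q0 psi, forall w, forall t, w.2 = Some t ->
    lrt_at z p0 p1 delta (history t w.1)}.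

(* E_{0,psi}[g(z * LR_T)] with g = min(1, .); the value at T = oo is
   immaterial for the policies that stop almost surely. *)
Definition expected_truncated_lr (z : R) p0 p1 (Q0 : probability (seqspace X) R)
    (psi : policy X R) : \bar R :=
  'E_(stop_law Q0 psi)[fun w => if w.2 is Some t
    then Num.min 1 (z * likelihood_ratio p0 p1 (history t w.1)) else 0].

End likelihood.

(* Main.v *)
(** Conditioning on the observations turns the weighted error of a decision rule
[delta] into an integral over (observations, stopping time) under H_0.  The type
II error is first written as the series over [t] of the integrals of
[stop_prob t * (1 - delta_t)] under H_1 (the policy stops almost surely, its
expected stopping time being finite); each term depends only on the first [t]
observations, so it can be moved to H_0 by inserting the likelihood ratio [L_t].
The resulting integrand at the stopping time is the convex combination
[delta * 1 + (1 - delta) * z L_T], which is at least [min 1 (z L_T)], with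
equality exactly when [delta] is a likelihood ratio test.  The integral of the
minimum being finite, any other minimizer attains it almost surely. *)
From HB Require Import structures.
Require Import Defs.
From mathcomp Require Import all_boot all_order all_algebra.
From mathcomp Require Import all_classical all_reals all_analysis.
From mathcomp Require Import measurable_realfun ring lra.
Set Implicit Arguments.
Unset Strict Implicit.
Unset Printing Implicit Defensive.
Import Order.TTheory GRing.Theory Num.Theory.
Local Open Scope classical_set_scope.
Local Open Scope ring_scope.
Local Open Scope ereal_scope.

(** * Integration against mixtures *)

Section integral_mixture.
Context d d' (S : measurableType d) (T : measurableType d') (R : realType).
Variables (nu : {measure set S -> \bar R}) (m : {measure set T -> \bar R}).
Variable k : S -> {measure set T -> \bar R}.
Hypothesis mk : forall A, measurable A -> measurable_fun [set: S] (k ^~ A).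
Hypothesis mE : forall A, measurable A -> m A = \int[nu]_s k s A.
Import HBNNSimple.

Let integral_mixture_nnsfun (f : {nnsfun T >-> R}) :
  \int[m]_t (f t)%:E = \int[nu]_s \int[k s]_t (f t)%:E.
Proof.
rewrite integralT_nnsfun sintegralE.
under [RHS]eq_integral do rewrite integralT_nnsfun sintegralE.
have mf r : measurable (f @^-1` [set r]) by by [].
rewrite ge0_integral_fsum//; last 2 first.
  by move=> r; apply: emeasurable_funM => //; exact: mk.
  by move=> r s _; exact: nnsfun_mulemu_ge0.
(* A nonnegative [r] can be pulled out of the integral; a negative [r] has an empty preimage, so
   both terms vanish. *)
apply: eq_fsbigr => r _; have [r0|r0] := leP 0%R r.
  by rewrite ge0_integralZl_EFin ?mE//; exact: mk.
rewrite preimage_nnfun0// measure0 mule0 integral0_eq// => s _.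
by rewrite measure0 mule0.
Qed.

(** Linearity gives the claim for simple functions. An increasing approximation of [f] extends it:
    monotone convergence is applied to [m], to each [k s], and then to the outer integral over
    [nu]. *)
Lemma ge0_integral_mixture (f : T -> \bar R) :
  measurable_fun [set: T] f -> (forall t, 0 <= f t) ->
  \int[m]_t f t = \int[nu]_s \int[k s]_t f t.
Proof.
move=> mf f0; pose g := nnsfun_approx measurableT mf.
have mg n : measurable_fun [set: T] (EFin \o g n) by exact/measurable_EFinP.
have g0 n t : 0 <= (g n t)%:E by rewrite lee_fin.
have ndg t : {homo (fun n => (g n t)%:E) : a b / (a <= b)%N >-> a <= b}.
  by move=> a b ab; rewrite lee_fin; exact/lefP/nd_nnsfun_approx.
have gf t : limn (fun n => (g n t)%:E) = f t.
  by apply/cvg_lim => //; exact: cvg_nnsfun_approx.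
have intg (l : {measure set T -> \bar R}) :
    \int[l]_t f t = limn (fun n => \int[l]_t (g n t)%:E).
  by rewrite -monotone_convergence//; apply: eq_integral => t _; rewrite gf.
rewrite intg (_ : (fun _ => _) = fun n => \int[nu]_s \int[k s]_t (g n t)%:E).
  rewrite -monotone_convergence//.
  - by apply: eq_integral => s _; rewrite intg.
  - move=> n; exact: (measurable_fun_integral_kernel mk (g0 n) (mg n)).
  - by move=> n s _; exact: integral_ge0.
  - by move=> s _ a b ab; apply: ge0_le_integral => //;
      last (by move=> t _; exact: ndg); exact: mg.
by apply/funext => n; exact: integral_mixture_nnsfun.
Qed.

End integral_mixture.

(** * Measures given by a weight and a map *)

Section weighted_dirac.
Context d d' (S : measurableType d) (T : measurableType d') (R : realType).
Variables (w : S -> R) (phi : S -> T).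
Hypotheses (w0 : forall s, (0 <= w s)%R) (mw : measurable_fun [set: S] w).
Hypothesis mphi : measurable_fun [set: S] phi.

(** As a family indexed by [s], these point masses turn the image of a weighted measure into a
    mixture, so that integrals against it need no separate argument. *)
Definition weighted_dirac (s : S) : {measure set T -> \bar R} :=
  mscale (NngNum (w0 s)) (dirac (phi s)).

Lemma weighted_diracE s A : weighted_dirac s A = (w s * \1_A (phi s))%:E.
Proof. by rewrite /weighted_dirac /= /mscale /= diracE -indicE. Qed.

Lemma measurable_weighted_dirac A : measurable A ->
  measurable_fun [set: S] (weighted_dirac ^~ A).
Proof.
move=> mA; rewrite (_ : weighted_dirac ^~ A =
    fun s => (w s * \1_A (phi s))%:E); last first.
  by apply/funext => s; exact: weighted_diracE.
apply/measurable_EFinP; apply: measurable_funM => //.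
by apply: measurableT_comp => //; exact: measurable_indic.
Qed.

Lemma ge0_integral_weighted_dirac s (f : T -> \bar R) :
  measurable_fun [set: T] f -> (forall t, 0 <= f t) ->
  \int[weighted_dirac s]_t f t = (w s)%:E * f (phi s).
Proof.
by move=> mf f0; rewrite ge0_integral_mscale// integral_dirac// diracT mul1e.
Qed.

(** This common form serves for densities ([phi] the identity), for one coordinate of an i.i.d.
    sequence weighted by the other factors, and for the likelihood ratio ([phi] the finite
    history). *)
Lemma ge0_integral_weighted (nu : {measure set S -> \bar R})
    (m : {measure set T -> \bar R}) (f : T -> \bar R) :
  (forall A, measurable A -> m A = \int[nu]_s (w s * \1_A (phi s))%:E) ->
  measurable_fun [set: T] f -> (forall t, 0 <= f t) ->
  \int[m]_t f t = \int[nu]_s ((w s)%:E * f (phi s)).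
Proof.
move=> mE mf f0.
rewrite (@ge0_integral_mixture _ _ _ _ _ nu m weighted_dirac)//.
  by apply: eq_integral => s _; rewrite ge0_integral_weighted_dirac.
exact: measurable_weighted_dirac.
Qed.

(** This is the image under [phi] of the measure with density [w] with respect to [nu]. *)
Definition weighted_image (nu : {measure set S -> \bar R}) (A : set T) :
    \bar R :=
  \int[nu]_s weighted_dirac s A.

Section weighted_image_measure.
Variable nu : {measure set S -> \bar R}.

Let weighted_image0 : weighted_image nu set0 = 0.
Proof. by apply: integral0_eq => s _; rewrite measure0. Qed.

Let weighted_image_ge0 A : 0 <= weighted_image nu A.
Proof. exact: integral_ge0. Qed.

Let weighted_image_sigma_additive : semi_sigma_additive (weighted_image nu).
Proof.
move=> A mA tA mUA; rewrite /weighted_image.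
rewrite [X in _ --> X](_ : _ =
    \sum_(0 <= i <oo) \int[nu]_s weighted_dirac s (A i)).
  by apply: is_cvg_nneseries => n _ _; exact: integral_ge0.
rewrite -integral_nneseries//; last first.
  by move=> n; exact: measurable_weighted_dirac.
apply: eq_integral => s _; rewrite measure_bigcup//.
by apply: eq_eseriesl => n; rewrite in_setT.
Qed.

HB.instance Definition _ := isMeasure.Build _ _ _ (weighted_image nu)
  weighted_image0 weighted_image_ge0 weighted_image_sigma_additive.

Definition weighted_image_measure : {measure set T -> \bar R} :=
  weighted_image nu.

End weighted_image_measure.

Lemma weighted_imageE (nu : {measure set S -> \bar R}) A :
  weighted_image nu A = \int[nu]_s (w s * \1_A (phi s))%:E.
Proof. by apply: eq_integral => s _; rewrite weighted_diracE. Qed.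

End weighted_dirac.

Lemma ge0_integral_density d (X : measurableType d) (R : realType)
    (mu : {measure set X -> \bar R}) (P : probability X R) (p : X -> R)
    (f : X -> \bar R) :
  is_density mu P p -> measurable_fun [set: X] f -> (forall x, 0 <= f x) ->
  \int[P]_x f x = \int[mu]_x ((p x)%:E * f x).
Proof.
case=> mp p0 PE mf f0.
apply: (ge0_integral_weighted p0 mp (@measurable_id _ _ _)) => // A mA.
rewrite [LHS]PE// integral_mkcond; apply: eq_integral => x _.
by rewrite patchE indicE; case: ifPn => _; rewrite ?mulr1 ?mulr0.
Qed.

Definition pushforward_measure d d' (S : measurableType d)
    (T : measurableType d') (R : realType) (m : {measure set S -> \bar R})
    (phi : S -> T) (mphi : measurable_fun [set: S] phi) :
  {measure set T -> \bar R}.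
Proof. by refine (pushforward m phi : {measure set T -> \bar R}). Defined.

(** The joint law is the mixture over [s] of the images of [k s] under [t |-> (s, t)], and such an
    image gives [A] the mass of its section at [s]. *)
Lemma ge0_integral_joint_law d d' (S : measurableType d)
    (T : measurableType d') (R : realType) (P : probability S R)
    (k : R.-pker S ~> T) (f : S * T -> \bar R) :
  measurable_fun [set: S * T] f -> (forall w, 0 <= f w) ->
  \int[joint_law P k]_w f w = \int[P]_s \int[k s]_t f (s, t).
Proof.
move=> mf f0.
have mpair s : measurable_fun [set: T] (pair s : T -> S * T).
  exact: pair1_measurable.
pose k' s : {measure set (S * T) -> \bar R} :=
  pushforward_measure (k s) (mpair s).
have k'E s A : k' s A = k s (xsection A s).
  by rewrite xsectionE.
rewrite (@ge0_integral_mixture _ _ _ _ _ P _ k')//.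
- apply: eq_integral => s _; rewrite ge0_integral_pushforward//.
- move=> A mA; under eq_fun do rewrite k'E.
  by apply: measurable_fun_xsection_finite_kernel; rewrite inE.
- by move=> A mA; apply: eq_integral => s _; rewrite k'E.
Qed.

Lemma ge0_integral_stop_kernel d (X : measurableType d) (R : realType)
    (psi : policy X R) (x : seqspace X) (f : option nat -> \bar R) :
  (forall o, 0 <= f o) ->
  \int[stop_kernel psi x]_o f o =
  \sum_(0 <= t <oo) ((stop_prob psi t x)%:E * f (Some t))
  + (never_prob psi x)%:E * f None.
Proof.
move=> f0; have mf : measurable_fun [set: option nat] f by [].
rewrite /stop_kernel /kadd ge0_integral_measure_add//.
rewrite ge0_integral_measure_series//.
congr (_ + _).
  apply: eq_eseriesr => t _.
  by rewrite /kstop_at ge0_integral_mscale// integral_dirac// diracT mul1e.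
by rewrite /kstop_at ge0_integral_mscale// integral_dirac// diracT mul1e.
Qed.

(** * Integrals of functions evaluated at the stopping time *)

(** Since [option nat] is countable with measurable points, a preimage is a countable union of
    measurable slices, each times a singleton. *)
Lemma measurable_fun_option d d' (S : measurableType d) (T : measurableType d')
    (f : S * option nat -> T) :
  (forall o, measurable_fun [set: S] (fun s => f (s, o))) ->
  measurable_fun [set: S * option nat] f.
Proof.
move=> mf _ B mB; rewrite setTI (_ : _ @^-1` B =
    \bigcup_t ([set s | B (f (s, Some t))] `*` [set Some t])
    `|` [set s | B (f (s, None))] `*` [set None]); last first.
  apply/seteqP.
  split => [[s [t|]] /= Bs|[s o] /= [[t _ /= [Bs ->]]|[Bs ->]]] //.
    by left; exists t.
  by right.
have mslice o : measurable [set s | B (f (s, o))].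
  by rewrite -[X in measurable X]setTI; exact: mf.
apply: measurableU; last exact: measurableX.
by apply: bigcupT_measurable => t; exact: measurableX.
Qed.

Section stop_law_integral.
Context d (X : measurableType d) (R : realType).
Implicit Types (Q : probability (seqspace X) R) (psi delta : policy X R).
Implicit Types (G : forall t, t.-tuple X -> R).

(** The default value 0 on [None] removes the event of never stopping from all integrals, which thus
    become plain series over [t]. *)
Definition at_stop G (w : seqspace X * option nat) : R :=
  if w.2 is Some t then G t (history t w.1) else 0%R.

Lemma measurable_at_stop G :
  (forall t, measurable_fun [set: t.-tuple X] (@G t)) ->
  measurable_fun [set: seqspace X * option nat] (at_stop G).
Proof.
move=> mG; apply: measurable_fun_option => -[t|] //.
apply: (measurableT_comp (mG t)); exact: measurable_history.
Qed.

(** Pointwise nonnegativity at each history suffices, the default value being 0. *)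
Lemma at_stop_ge0 G w : (forall t u, (0 <= G t u)%R) -> (0 <= at_stop G w)%R.
Proof. by move=> G0; rewrite /at_stop; case: w.2. Qed.

Lemma integral_at_stop Q psi G :
  (forall t, measurable_fun [set: t.-tuple X] (@G t)) ->
  (forall t u, (0 <= G t u)%R) ->
  \int[stop_law Q psi]_w (at_stop G w)%:E =
  \sum_(0 <= t <oo) \int[Q]_x (stop_prob psi t x * G t (history t x))%:E.
Proof.
move=> mG G0; rewrite ge0_integral_joint_law; last 2 first.
- by apply/measurable_EFinP; exact: measurable_at_stop.
- by move=> w; rewrite lee_fin at_stop_ge0.
rewrite -integral_nneseries//; last 2 first.
- move=> t; apply/measurable_EFinP; apply: measurable_funM.
    exact: (measurable_stop_weight psi (Some t)).
  by apply: (measurableT_comp (mG t)); exact: measurable_history.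
- by move=> t x _; rewrite lee_fin mulr_ge0// (stop_weight_ge0 psi (Some t)).
apply: eq_integral => x _; rewrite ge0_integral_stop_kernel; last first.
  by move=> o; rewrite lee_fin at_stop_ge0.
by rewrite mule0 adde0; apply: eq_eseriesr => t _; rewrite EFinM.
Qed.

(** The decision is a Bernoulli variable whose parameter lies in [0, 1] also on [None], where it is
    0. *)
Lemma ge0_integral_decision_kernel delta w (f : bool -> \bar R) :
  (forall b, 0 <= f b) ->
  \int[decision_kernel delta w]_b f b =
  (decision_prob delta w)%:E * f true
  + (1 - decision_prob delta w)%:E * f false.
Proof.
move=> f0; rewrite [LHS]integral_bernoulli_prob//.
rewrite /decision_prob; case: w.2 => [t|]; last by rewrite lexx ler01.
exact: policy_itv.
Qed.

Lemma ge0_integral_test_law Q psi delta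
    (f : seqspace X * option nat * bool -> \bar R) :
  measurable_fun setT f -> (forall v, 0 <= f v) ->
  \int[test_law Q psi delta]_v f v =
  \int[stop_law Q psi]_w ((decision_prob delta w)%:E * f (w, true)
    + (1 - decision_prob delta w)%:E * f (w, false)).
Proof.
move=> mf f0; rewrite ge0_integral_joint_law//.
by apply: eq_integral => w _; rewrite ge0_integral_decision_kernel.
Qed.

Lemma measurable_decision :
  measurable_fun [set: seqspace X * option nat * bool] (@decision d X R).
Proof.
rewrite /decision (_ : (fun _ => _) = (fun b : bool => b%:R : R) \o snd)//.
exact: measurableT_comp.
Qed.

Lemma type1_errorE Q psi delta :
  type1_error Q psi delta = \int[stop_law Q psi]_w (at_stop delta w)%:E.
Proof.
rewrite /type1_error unlock ge0_integral_test_law.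
- by apply: eq_integral => w _; rewrite /decision /= mule1 mule0 adde0.
- by apply/measurable_EFinP; exact: measurable_decision.
- by move=> v; rewrite lee_fin /decision ler0n.
Qed.

(** A test that never stops has decision 0 and so costs 1 here: the integrand is
    [1 - at_stop delta], which differs on [None] from [at_stop] of [1 - delta]. *)
Lemma type2_errorE Q psi delta : type2_error Q psi delta =
  \int[stop_law Q psi]_w (1 - at_stop delta w)%:E.
Proof.
rewrite /type2_error unlock ge0_integral_test_law.
- apply: eq_integral => w _.
  by rewrite /decision /= subrr mule0 add0e subr0 mule1.
- by apply/measurable_EFinP; apply: measurable_funB => //;
    exact: measurable_decision.
- by move=> v; rewrite lee_fin subr_ge0 /decision lern1 leq_b1.
Qed.

(** The stopping time is [+oo] on this event, so a positive probability would make its expectation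
    infinite, against the bound [c]. *)
Lemma stop_law_never c Q psi : uniformly_bounded_stopping c psi ->
  stop_law Q psi [set w | w.2 = None] = 0.
Proof.
move=> psic.
have mN : measurable [set w : seqspace X * option nat | w.2 = None].
  rewrite (_ : [set _ | _] = setT `*` [set None]); first exact: measurableX.
  by apply/seteqP; split => -[x o] //= [].
have mT : measurable_fun setT (@stopping_time d X R).
  by apply: measurable_fun_option => -[t|]; exact: measurable_cst.
apply/eqP/negPn/negP => N0; have := psic Q; apply/negP; rewrite -ltNge.
apply: (@lt_le_trans _ _ (\int[stop_law Q psi]_(w in [set w | w.2 = None])
  (@stopping_time d X R) w)).
  rewrite (eq_integral (cst +oo)); last first.
    by move=> [x o]; rewrite inE /= => ->.
  by rewrite integral_cst// gt0_mulye ?ltry// lt0e N0 measure_ge0.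
apply: ge0_subset_integral => //.
by move=> [x [t|]] _; rewrite /stopping_time //= lee_fin.
Qed.

(** The two integrands differ only on [None], a null event for a policy with bounded expected
    stopping time. *)
Lemma type2_error_at_stop c Q psi delta : uniformly_bounded_stopping c psi ->
  type2_error Q psi delta =
  \int[stop_law Q psi]_w (at_stop (fun t u => 1 - delta t u)%R w)%:E.
Proof.
move=> psic; rewrite type2_errorE; apply: ge0_ae_eq_integral => //.
- apply/measurable_EFinP; apply: measurable_funB => //.
  by apply: measurable_at_stop => t; exact: measurable_policy.
- apply/measurable_EFinP; apply: measurable_at_stop => t.
  by apply: measurable_funB => //; exact: measurable_policy.
- move=> [x [t|]] _; rewrite lee_fin subr_ge0 //=.
  by have /andP[] := policy_itv delta (history t x).
- move=> w _; rewrite lee_fin; apply: at_stop_ge0 => t u; rewrite subr_ge0.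
  by have /andP[] := policy_itv delta u.
exists [set w | w.2 = None]; split.
- rewrite (_ : [set _ | _] = setT `*` [set None]); first exact: measurableX.
  by apply/seteqP; split => -[x o] //= [].
- exact: stop_law_never psic.
- by move=> [x [t|]] //= /not_implyP[_]; rewrite /at_stop.
Qed.

End stop_law_integral.

(** * Change of measure on finite histories *)

Lemma integral_prod_iid d (X : measurableType d) (R : realType)
    (P : probability X R) (Q : probability (seqspace X) R) t
    (f : 'I_t -> X -> R) (e : 'I_t -> R) :
  iid_law P Q -> (forall i, measurable_fun [set: X] (f i)) ->
  (forall i x, (0 <= f i x)%R) -> (forall i, \int[P]_x (f i x)%:E = (e i)%:E) ->
  \int[Q]_x (\prod_(i < t) f i (x i))%:E = (\prod_(i < t) e i)%:E.
Proof.
(* Induction on [k], where all the factors of index at least [k] are indicators: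
   both sides, seen as measures of [A] when factor [k] is [\1_A], agree. *)
move=> iidQ; suff H k : forall (f : 'I_t -> X -> R) (e : 'I_t -> R),
    (forall i, measurable_fun [set: X] (f i)) ->
    (forall i x, (0 <= f i x)%R) ->
    (forall i, \int[P]_x (f i x)%:E = (e i)%:E) ->
    (forall i : 'I_t, (k <= i)%N -> exists2 A, measurable A & f i = \1_A) ->
    \int[Q]_x (\prod_(i < t) f i (x i))%:E = (\prod_(i < t) e i)%:E.
  by move=> mf f0 fe; apply: (H t) => // i; rewrite leqNgt ltn_ord.
elim: k => [|k IH] {}f {}e mf f0 fe find.
  have /choice[A AP] : forall i, exists A, measurable A /\ f i = \1_A.
    by move=> i; have [//|A mA fA] := find i; exists A.
  have mA i : measurable (A i) by have [] := AP i.
  have fA i : f i = \1_(A i) by have [] := AP i.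
  have eA i : (e i)%:E = P (A i).
    by rewrite -fe fA integral_indic// setIT.
  pose B := [set x : seqspace X | forall i : 'I_t, A i (x i)].
  have mB : measurable B.
    rewrite (_ : B = \bigcap_(i in [set: 'I_t]) ((fun x => x i) @^-1` A i)).
      apply: fin_bigcap_measurable => // i _.
      by rewrite -[X in measurable X]setTI; exact: measurable_coord.
    by apply/seteqP; split => x Bx i; [move=> _; exact: Bx|exact: (Bx i I)].
  (* When all factors are indicators, their product is the indicator of [B], whose probability
     [iid_law] gives. *)
  rewrite (eq_integral (fun x => (\1_B x)%:E)).
    rewrite integral_indic// setIT [LHS]iidQ//.
    by rewrite -prodEFin; apply: eq_bigr => i _; rewrite eA.
  move=> x _; congr EFin; rewrite indicE.
  have [xB|xB] := boolP (x \in B).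
    by rewrite big1// => i _; rewrite fA indicE mem_set//; rewrite inE in xB.
  have [i Ai] : exists i : 'I_t, ~ A i (x i).
    by apply/existsNP; move: xB; rewrite notin_setE.
  by rewrite (bigD1 i)//= fA indicE memNset// mul0r.
have [kt|tk] := ltnP k t; last first.
  by apply: IH => // i ki; have := leq_ltn_trans (leq_trans tk ki) (ltn_ord i);
    rewrite ltnn.
pose j := Ordinal kt.
have e0 i : (0 <= e i)%R.
  by rewrite -lee_fin -fe; apply: integral_ge0 => x _; rewrite lee_fin.
pose w (x : seqspace X) := (\prod_(i < t | i != j) f i (x i))%R.
have w0 x : (0 <= w x)%R by exact: prodr_ge0.
have mw : measurable_fun [set: seqspace X] w.
  rewrite (_ : w = fun x => \prod_(i < t)
      (if i != j then f i (x i) else 1))%R; last first.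
    by apply/funext => x; rewrite /w big_mkcond.
  apply: measurable_prod => i _; case: (i != j) => //.
  by apply: (measurableT_comp (mf i)); exact: measurable_coord.
have c0 : (0 <= \prod_(i < t | i != j) e i)%R by exact: prodr_ge0.
rewrite (bigD1 j)//= mulrC.
(* Both sides become integrals of the single factor [f j]: on the right against [P] scaled by the
   other means, on the left against the image under coordinate [j] of [Q] with density [w]. *)
transitivity (\int[mscale (NngNum c0) P]_y (f j y)%:E); last first.
  rewrite ge0_integral_mscale//; last 2 first.
    exact/measurable_EFinP.
    by move=> y _; rewrite lee_fin.
  by rewrite /= fe EFinM.
rewrite (@ge0_integral_weighted _ _ _ _ _ w (fun x => x j) w0 mw
  (@measurable_coord _ _ _) Q).
- by apply: eq_integral => x _; rewrite (bigD1 j)//= mulrC EFinM.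
- move=> A mA /=; rewrite /mscale /=.
  (* With [\1_A] in place of factor [j], all factors from index [k] on are indicators, so the
     induction hypothesis identifies the two measures at [A]. *)
  pose f' i := if i == j then \1_A else f i.
  pose e' i := if i == j then fine (P A) else e i.
  have := IH f' e'; rewrite (bigD1 j)//= /e' eqxx mulrC EFinM.
  rewrite fineK ?fin_num_measure//.
  under eq_bigr => i /negPf -> do [].
  move=> <-.
  + apply: eq_integral => x _; rewrite (bigD1 j)//= /f' eqxx mulrC.
    by congr (_ * _)%:E; apply: eq_bigr => i /negPf ->.
  + by move=> i; rewrite /f'; case: ifP => _ //; exact: measurable_indic.
  + by move=> i x; rewrite /f'; case: ifP => _ //; rewrite indicE.
  + move=> i; rewrite /f'; case: ifP => _ //.
    by rewrite integral_indic// setIT fineK// fin_num_measure.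
  + move=> i ki; rewrite /f'; case: eqP => [_|/eqP ij]; first by exists A.
    by apply: find; rewrite ltn_neqAle ki andbT eq_sym.
- exact/measurable_EFinP.
- by move=> y; rewrite lee_fin.
Qed.

(** Rectangles are stable under intersection and generate the product sigma-algebra; as the total
    mass is finite, the constant sequence [setT] is an exhaustion and measures agreeing on
    rectangles coincide. *)
Lemma tuple_measure_unique d (X : measurableType d) (R : realType) t
    (m1 m2 : {measure set (t.-tuple X) -> \bar R}) :
  m1 setT < +oo ->
  (forall B : 'I_t -> set X, (forall i, measurable (B i)) ->
    m1 [set u | forall i, B i (tnth u i)] =
    m2 [set u | forall i, B i (tnth u i)]) ->
  forall A, measurable A -> m1 A = m2 A.
Proof.
move=> m1fin m12.
pose G := [set A : set (t.-tuple X) | exists2 B : 'I_t -> set X,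
  (forall i, measurable (B i)) & A = [set u | forall i, B i (tnth u i)]].
have GT : G setT.
  by exists (fun=> setT) => //; apply/seteqP; split.
apply: (@measure_unique _ _ _ G (fun=> setT)) => //.
- apply/seteqP; split.
    apply: smallest_sub; first exact: smallest_sigma_algebra.
    apply: (big_ind (fun E : set_system (t.-tuple X) => E `<=` <<s G >>)) => //.
      by move=> E F EG FG A [/EG|/FG].
    move=> i _ _ [A mA <-]; apply: sub_sigma_algebra.
    (* A condition on coordinate [i] alone is a rectangle whose other sides are full. *)
    exists (fun j => if j == i then A else setT) => [j|].
      by case: (j == i).
    rewrite setTI; apply/seteqP; split => u /= Au.
      by move=> j; case: eqP => // ->.
    by have := Au i; rewrite eqxx.
  apply: smallest_sub; first exact: sigma_algebra_measurable.
  move=> _ [B mB ->].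
  rewrite (_ : [set _ | _] =
      \bigcap_(i in [set: 'I_t]) ((fun u => tnth u i) @^-1` B i)).
    apply: fin_bigcap_measurable => // i _.
    by rewrite -[X in measurable X]setTI; exact: measurable_tnth.
  by apply/seteqP; split => u Bu i; [move=> _; exact: Bu|exact: (Bu i I)].
- move=> _ _ [B mB ->] [C mC ->]; exists (fun i => B i `&` C i) => [i|].
    exact: measurableI.
  by apply/seteqP; split => u /=; [move=> [Bu Cu] i; split|
    move=> BCu; split => i; have [] := BCu i].
- by rewrite bigcup_const.
- by move=> _ [B mB ->]; exact: m12.
Qed.

(** * Likelihood ratios as densities of finite histories *)

Section likelihood_ratio.
Context d (X : measurableType d) (R : realType).
Variables (mu : {measure set X -> \bar R}) (P0 P1 : probability X R).
Variables (p0 p1 : X -> R).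
Hypotheses (hp0 : is_density mu P0 p0) (hp1 : is_density mu P1 p1).
Hypothesis P1P0 : P1 `<< P0.

Let ratio_ge0 x : (0 <= p1 x / p0 x)%R.
Proof. by have [_ + _] := hp0; have [_ + _] := hp1 => *; exact: divr_ge0. Qed.

Let measurable_ratio : measurable_fun [set: X] (fun x => p1 x / p0 x)%R.
Proof.
have [mp0 p00 _] := hp0; have [mp1 _ _] := hp1.
apply: measurable_funM => //.
(* [powR] is known to be measurable, and [y^-1 = y `^ -1] for [0 <= y]. *)
rewrite (_ : (fun _ => _) = (fun y => y `^ -1) \o p0)%R.
  by apply: measurableT_comp => //; exact: measurable_powR.
by apply/funext => x /=; rewrite powRN powRr1.
Qed.

Let zeros := [set x | p0 x = 0%R].

Let measurable_zeros : measurable zeros.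
Proof.
rewrite (_ : zeros = setT `&` p0 @^-1` [set 0%R]); last by rewrite setTI.
by have [mp0 _ _] := hp0; exact: mp0.
Qed.

Lemma density_eq0_null : P0 [set x | p0 x = 0%R] = 0.
Proof.
have [mp0 p00 P0E] := hp0.
rewrite [LHS]P0E; last exact: measurable_zeros.
by apply: integral0_eq => x /= ->.
Qed.

(* The junk value [p1 x / 0] does not matter, as [P1] does not charge the zeros
   of [p0]. *)
Lemma integral_density_ratio A : measurable A ->
  \int[P0]_x (p1 x / p0 x * \1_A x)%:E = P1 A.
Proof.
move=> mA; have [mp0 p00 P0E] := hp0; have [mp1 p10 P1E] := hp1.
have P1Z : P1 zeros = 0.
  by apply: (null_content_dominatesP P1 P0).1 => //; exact: density_eq0_null.
rewrite (ge0_integral_density hp0); last 2 first.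
- by apply/measurable_EFinP; apply: measurable_funM => //;
    exact: measurable_indic.
- by move=> x; rewrite lee_fin mulr_ge0.
(* Where [p0] is nonzero, [p0 * (p1 / p0)] is [p1]; on its zeros the integrand vanishes, so these
   points are removed from [A]. *)
transitivity (P1 (A `\` zeros)).
  rewrite P1E; last exact: measurableD.
  rewrite [RHS]integral_mkcond; apply: eq_integral => x _.
  rewrite patchE indicE -EFinM.
  have [xAZ|xAZ] := boolP (x \in A `\` zeros).
    move: xAZ; rewrite inE => -[xA xZ].
    rewrite mem_set// mulr1 mulrC divfK//; exact/eqP.
  have [xA|xA] := boolP (x \in A); last by rewrite !mulr0.
  have -> : p0 x = 0%R; last by rewrite mul0r.
  apply: contrapT => xZ; move: xAZ; rewrite notin_setE; apply; split => //.
  by rewrite inE in xA.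
rewrite measureD ?(le_lt_trans (probability_le1 _ _)) ?ltry//.
rewrite (@subset_measure0 _ _ _ P1 (A `&` zeros) zeros) ?sube0//.
exact: measurableI.
Qed.

Section change_of_measure.
Variables (Q0 Q1 : probability (seqspace X) R).
Hypotheses (hQ0 : iid_law P0 Q0) (hQ1 : iid_law P1 Q1).
Variable t : nat.

Lemma likelihood_ratio_ge0 (u : t.-tuple X) :
  (0 <= likelihood_ratio p0 p1 u)%R.
Proof. by apply: prodr_ge0 => i _; exact: ratio_ge0. Qed.

Lemma measurable_likelihood_ratio :
  measurable_fun [set: t.-tuple X] (@likelihood_ratio d X R p0 p1 t).
Proof.
apply: measurable_prod => i _.
by apply: (measurableT_comp measurable_ratio); exact: measurable_tnth.
Qed.

Let lr_history x := likelihood_ratio p0 p1 (history t x).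

Let lr_history_ge0 x : (0 <= lr_history x)%R.
Proof. exact: likelihood_ratio_ge0. Qed.

Let measurable_lr_history : measurable_fun [set: seqspace X] lr_history.
Proof.
apply: (measurableT_comp measurable_likelihood_ratio).
exact: measurable_history.
Qed.

(** The law of the history under [Q1] has the likelihood ratio as density with respect to its law
    under [Q0]. By uniqueness this is checked on rectangles, where both sides factor over the
    coordinates. *)
Lemma change_of_measure_history (F : t.-tuple X -> \bar R) :
  measurable_fun [set: t.-tuple X] F -> (forall u, 0 <= F u) ->
  \int[Q1]_x F (history t x) =
  \int[Q0]_x ((likelihood_ratio p0 p1 (history t x))%:E * F (history t x)).
Proof.
move=> mF F0.
pose m1 := pushforward_measure Q1 (@measurable_history _ X t).
transitivity (\int[m1]_u F u).
  by rewrite /m1 /pushforward_measure ge0_integral_pushforward//;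
    exact: measurable_history.
apply: (ge0_integral_weighted lr_history_ge0 measurable_lr_history
  (@measurable_history _ X t)) => // A mA.
rewrite -weighted_imageE//.
apply: (@tuple_measure_unique _ _ _ _ m1 (weighted_image_measure
  lr_history_ge0 measurable_lr_history (@measurable_history _ X t) Q0)) => //.
  by rewrite /m1 /= /pushforward preimage_setT probability_setT ltry.
move=> B mB.
rewrite /= weighted_imageE /pushforward.
have -> : history t @^-1` [set u | forall i, B i (tnth u i)] =
    [set x : seqspace X | forall i : 'I_t, B i (x i)].
  by apply/seteqP; split => x /= Bx i; have := Bx i; rewrite tnth_mktuple.
rewrite hQ1//.
(* The ratio and the indicator of the rectangle both split over coordinates; under [P0] factor [i]
   has mean [P1 (B i)]. *)
transitivity (\int[Q0]_x (\prod_(i < t)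
    (p1 (x i) / p0 (x i) * \1_(B i) (x i)))%:E).
  rewrite (@integral_prod_iid _ _ _ P0 Q0 t
    (fun i x => p1 x / p0 x * \1_(B i) x)%R (fun i => fine (P1 (B i))))//.
  - rewrite -prodEFin; apply: eq_bigr => i _.
    by rewrite fineK ?fin_num_measure.
  - by move=> i; apply: measurable_funM => //; exact: measurable_indic.
  - by move=> i x; rewrite mulr_ge0.
  - by move=> i; rewrite integral_density_ratio// fineK ?fin_num_measure.
apply: eq_integral => x _; congr EFin; rewrite big_split /=; congr (_ * _)%R.
  by apply: eq_bigr => i _; rewrite tnth_mktuple.
rewrite indicE; case: (boolP (_ \in _)) => [|Bx].
  rewrite inE /= => Bx; rewrite big1// => i _; rewrite indicE mem_set//.
  by have := Bx i; rewrite tnth_mktuple.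
have [i Bi] : exists i : 'I_t, ~ B i (x i).
  apply/existsNP => Bx'; move: Bx; rewrite notin_setE; apply => i.
  by rewrite tnth_mktuple.
by rewrite (bigD1 i)//= indicE memNset// mul0r.
Qed.

End change_of_measure.

End likelihood_ratio.

(** * The Bayes cost at the stopping time *)

Section history_extension.
Context d (X : measurableType d) (t : nat).

(* A right inverse of [history t]: it exhibits the time-[t] stopping
   probability, defined on sequences, as a measurable function of the first [t]
   observations. *)
Definition extend_history (u : t.-tuple X) : seqspace X :=
  fun n => nth point u n.

Lemma measurable_extend_history :
  measurable_fun [set: t.-tuple X] extend_history.
Proof.
apply: (measurability (rT := seqspace X) (@cylinder _ X) erefl).
suff mnth n : measurable_fun [set: t.-tuple X] (fun u => nth point u n).
  by move=> _ [_ [n _ [A mA <-]] <-]; rewrite setTI; exact: mnth.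
have [nt|tn] := ltnP n t.
  rewrite (_ : (fun _ => _) = fun u : t.-tuple X => tnth u (Ordinal nt)).
    exact: measurable_tnth.
  by apply/funext => u; rewrite (tnth_nth point).
rewrite (_ : (fun _ => _) = cst point); first exact: measurable_cst.
by apply/funext => u; rewrite nth_default// size_tuple.
Qed.

Lemma history_extend n (x : seqspace X) : (n <= t)%N ->
  history n (extend_history (history t x)) = history n x.
Proof.
move=> nt; apply: eq_from_tnth => i; rewrite !tnth_mktuple /extend_history.
have it : (i < t)%N by exact: leq_trans (ltn_ord i) nt.
by rewrite -(tnth_nth _ _ (Ordinal it)) tnth_mktuple.
Qed.

Lemma stop_prob_extend (R : realType) (psi : policy X R) (x : seqspace X) :
  stop_prob psi t (extend_history (history t x)) = stop_prob psi t x.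
Proof.
rewrite /stop_prob /survival history_extend//; congr (_ * _)%R.
by apply: eq_bigr => n _; rewrite history_extend// ltnW.
Qed.

End history_extension.

(** The stopping kernel has mass 1, so [Q] is the law of the observations under [stop_law Q psi] and
    its null sets carry over. *)
Lemma stop_law_setXT0 d (X : measurableType d) (R : realType)
    (Q : probability (seqspace X) R) (psi : policy X R) (A : set (seqspace X)) :
  measurable A -> Q A = 0 -> stop_law Q psi (A `*` setT) = 0.
Proof.
move=> mA QA0; transitivity (\int[Q]_x (\1_A x)%:E).
  apply: eq_integral => x _; rewrite indicE.
  have [xA|xA] := boolP (x \in A).
    by rewrite in_xsectionX// prob_kernel.
  by rewrite notin_xsectionX// measure0.
by rewrite integral_indic// setIT.
Qed.

Section bayes_cost.
Context d (X : measurableType d) (R : realType).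
Variables (mu : {measure set X -> \bar R}) (P0 P1 : probability X R).
Variables (p0 p1 : X -> R).
Hypotheses (hp0 : is_density mu P0 p0) (hp1 : is_density mu P1 p1).
Hypothesis P1P0 : P1 `<< P0.
Variables (Q0 Q1 : probability (seqspace X) R).
Hypotheses (hQ0 : iid_law P0 Q0) (hQ1 : iid_law P1 Q1).
Variables (z : R) (z_ge0 : (0 <= z)%R).

Let lr t (u : t.-tuple X) : R := likelihood_ratio p0 p1 u.

Definition bayes_cost (delta : policy X R) t (u : t.-tuple X) : R :=
  (delta t u + z * ((1 - delta t u) * lr u))%R.

Definition optimal_cost t (u : t.-tuple X) : R := Num.min 1%R (z * lr u)%R.

Let lr_ge0 t (u : t.-tuple X) : (0 <= lr u)%R.
Proof. exact: (likelihood_ratio_ge0 hp0 hp1). Qed.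

Let measurable_lr t : measurable_fun [set: t.-tuple X] (@lr t).
Proof. exact: (measurable_likelihood_ratio hp0 hp1). Qed.

Let policy_ge0 (delta : policy X R) t (u : t.-tuple X) : (0 <= delta t u)%R.
Proof. by have /andP[] := policy_itv delta u. Qed.

Let policy_onem_ge0 (delta : policy X R) t (u : t.-tuple X) :
  (0 <= 1 - delta t u)%R.
Proof. by rewrite subr_ge0; have /andP[] := policy_itv delta u. Qed.

Let measurable_onem_lr (delta : policy X R) t :
  measurable_fun [set: t.-tuple X] (fun u => (1 - delta t u) * lr u)%R.
Proof.
apply: measurable_funM; last exact: measurable_lr.
by apply: measurable_funB => //; exact: measurable_policy.
Qed.

Lemma bayes_cost_ge0 delta t (u : t.-tuple X) : (0 <= bayes_cost delta u)%R.
Proof. by rewrite addr_ge0// !mulr_ge0. Qed.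

Lemma measurable_bayes_cost delta t :
  measurable_fun [set: t.-tuple X] (@bayes_cost delta t).
Proof.
apply: measurable_funD; first exact: measurable_policy.
by apply: measurable_funM => //; exact: measurable_onem_lr.
Qed.

Lemma optimal_cost_ge0 t (u : t.-tuple X) : (0 <= optimal_cost u)%R.
Proof. by rewrite le_min ler01 mulr_ge0. Qed.

Lemma optimal_cost_le1 t (u : t.-tuple X) : (optimal_cost u <= 1)%R.
Proof. by rewrite ge_min lexx. Qed.

Lemma measurable_optimal_cost t :
  measurable_fun [set: t.-tuple X] (@optimal_cost t).
Proof. apply: measurable_minr => //; apply: measurable_funM => //.
exact: measurable_lr.
Qed.

(** The excess cost is [(1 - a) * (z * l - 1)] if [1 <= z * l] and [a * (1 - z * l)] otherwise, in
    both cases a product of nonnegative factors. *)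
Lemma optimal_cost_le_bayes delta t (u : t.-tuple X) :
  (optimal_cost u <= bayes_cost delta u)%R.
Proof.
rewrite /optimal_cost /bayes_cost; set a := delta t u; set l := lr u.
have a0 : (0 <= a)%R by exact: policy_ge0.
have a1 : (0 <= 1 - a)%R by exact: policy_onem_ge0.
rewrite minEle; case: (leP 1%R (z * l)%R) => zl.
  have H : (0 <= (1 - a) * (z * l - 1))%R by rewrite mulr_ge0// subr_ge0.
  by rewrite -subr_ge0 (_ : (_ - _ = (1 - a) * (z * l - 1))%R)//; ring.
have H : (0 <= a * (1 - z * l))%R by rewrite mulr_ge0// subr_ge0 ltW.
by rewrite -subr_ge0 (_ : (_ - _ = a * (1 - z * l))%R)//; ring.
Qed.

(** The excess cost factors into a term in [a] and a term in [z * l - 1]. Away from [z * l = 1] its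
    vanishing forces [a] to be 0 or 1; at the tie the cost is 1 whatever [a] is. *)
Lemma bayes_cost_eq_optimal delta t (u : t.-tuple X) :
  bayes_cost delta u = optimal_cost u <->
  [/\ (z * lr u < 1 -> delta t u = 0)%R,
      (z * lr u = 1 -> 0 <= delta t u <= 1)%R &
      (z * lr u > 1 -> delta t u = 1)%R].
Proof.
rewrite /optimal_cost /bayes_cost; set a := delta t u; set l := lr u.
rewrite minEle; split => [|[l1 _ g1]].
  have a01 : (0 <= a <= 1)%R by exact: policy_itv.
  case: (ltgtP 1%R (z * l)%R) => zl E; split => // _.
  - have /eqP : ((1 - a) * (z * l - 1) = 0)%R by nra.
    rewrite mulf_eq0 !subr_eq0 (gt_eqF zl) orbF.
    by move/eqP/esym.
  - have /eqP : (a * (1 - z * l) = 0)%R by nra.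
    by rewrite mulf_eq0 subr_eq0 (gt_eqF zl) orbF => /eqP.
case: (ltgtP 1%R (z * l)%R) => zl.
- by rewrite (g1 zl) subrr mul0r mulr0 addr0.
- by rewrite (l1 zl) subr0 mul1r add0r.
- by rewrite mulrCA -zl mulr1 subrKC.
Qed.

Variables (c : R) (psi : policy X R).
Hypothesis psic : uniformly_bounded_stopping c psi.

(** The change of measure is done separately for each [t]: on whole sequences [Q1] need not be
    absolutely continuous with respect to [Q0]. *)
Lemma type2_error_likelihood delta : type2_error Q1 psi delta =
  \int[stop_law Q0 psi]_w
    (at_stop (fun t u => (1 - delta t u) * lr u)%R w)%:E.
Proof.
rewrite (type2_error_at_stop Q1 delta psic) integral_at_stop//; last first.
  by move=> t; apply: measurable_funB => //; exact: measurable_policy.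
rewrite integral_at_stop//; last by move=> t u; rewrite mulr_ge0.
apply: eq_eseriesr => t _.
(* The stopping probability takes a sequence as argument; [extend_history] makes it a function of
   the history, as the change of measure requires. *)
pose F (u : t.-tuple X) : \bar R :=
  (stop_prob psi t (extend_history u) * (1 - delta t u))%:E.
transitivity (\int[Q1]_x F (history t x)).
  by apply: eq_integral => x _; rewrite /F stop_prob_extend.
rewrite (change_of_measure_history hp0 hp1 P1P0 hQ0 hQ1).
- apply: eq_integral => x _; rewrite /F stop_prob_extend -EFinM.
  by rewrite mulrC mulrA.
- apply/measurable_EFinP; apply: measurable_funM.
    apply: (measurableT_comp (measurable_stop_weight psi (Some t))).
    exact: measurable_extend_history.
  by apply: measurable_funB => //; exact: measurable_policy.
- move=> u; rewrite lee_fin mulr_ge0//.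
  exact: (stop_weight_ge0 psi (Some t)).
Qed.

Lemma weighted_errorE delta : weighted_error z Q0 Q1 psi delta =
  \int[stop_law Q0 psi]_w (at_stop (bayes_cost delta) w)%:E.
Proof.
have mH := measurable_at_stop (@measurable_onem_lr delta).
rewrite /weighted_error type1_errorE type2_error_likelihood.
rewrite -ge0_integralZl_EFin//; last 2 first.
- by move=> w _; rewrite lee_fin at_stop_ge0// => t u; rewrite mulr_ge0.
- exact/measurable_EFinP.
rewrite -ge0_integralD//.
- apply: eq_integral => -[x [t|]] _; rewrite /at_stop //=.
  by rewrite mule0 adde0.
- by move=> w _; rewrite lee_fin at_stop_ge0.
- apply/measurable_EFinP; apply: measurable_at_stop => t.
  exact: measurable_policy.
- move=> w _; rewrite mule_ge0 ?lee_fin ?at_stop_ge0// => t u.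
  by rewrite mulr_ge0.
- by apply/measurable_EFinP; exact: measurable_funM.
Qed.

End bayes_cost.

(** * Optimality of likelihood ratio tests and its converse *)

Section optimality.
Context d (X : measurableType d) (R : realType).
Variables (mu : {measure set X -> \bar R}) (P0 P1 : probability X R).
Variables (p0 p1 : X -> R).
Hypotheses (hp0 : is_density mu P0 p0) (hp1 : is_density mu P1 p1).
Variable Q0 : probability (seqspace X) R.
Hypothesis hQ0 : iid_law P0 Q0.
Variables (z : R) (z_ge0 : (0 <= z)%R).

Let zero_at n := [set x : seqspace X | p0 (x n) = 0%R].

Let measurable_zero_at n : measurable (zero_at n).
Proof.
have [mp0 _ _] := hp0.
rewrite (_ : zero_at n = setT `&` (p0 \o (fun x => x n)) @^-1` [set 0%R]).
  by apply: (measurableT_comp mp0 (@measurable_coord _ _ n)).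
by rewrite setTI.
Qed.

Let zero_at_null n : Q0 (zero_at n) = 0.
Proof.
have [mp0 _ _] := hp0.
(* As [iid_law] concerns initial segments, coordinate [n] is reached through a rectangle with [n.+1]
   sides, all full but the last. *)
pose A (i : 'I_n.+1) : set X :=
  if i == ord_max then [set x | p0 x = 0%R] else setT.
rewrite (_ : zero_at n = [set x | forall i : 'I_n.+1, A i (x i)]).
  rewrite [LHS]hQ0.
    by rewrite (bigD1 ord_max)//= {1}/A eqxx (density_eq0_null hp0) mul0e.
  move=> i; rewrite /A; case: ifP => // _.
  rewrite (_ : [set _ | _] = setT `&` p0 @^-1` [set 0%R]);
    last by rewrite setTI.
  exact: mp0.
apply/seteqP; split => x /=.
  by move=> x0 i; rewrite /A; case: eqP => // ->.
by move=> /(_ ord_max); rewrite /A eqxx.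
Qed.

(** A countable union of null events, one for each coordinate, is null. Hence the ratios
    constraining a likelihood ratio test are almost surely defined. *)
Lemma ae_stop_law_density_neq0 (psi : policy X R) :
  {ae stop_law Q0 psi, forall w n, p0 (w.1 n) != 0%R}.
Proof.
have mZ : measurable (\bigcup_n zero_at n) by exact: bigcupT_measurable.
exists ((\bigcup_n zero_at n) `*` setT); split.
- exact: measurableX.
- apply: stop_law_setXT0 => //; apply/eqP; rewrite -measure_le0.
  apply: (le_trans (measure_sigma_subadditive _ _ mZ _)) => //.
  by rewrite eseries0// => n _ _; exact: zero_at_null.
- move=> [x o] /= /existsNP[n /negP]; rewrite negbK => /eqP x0.
  by split => //; exists n.
Qed.

Lemma integral_bayes_cost_lrt (psi delta : policy X R) :
  is_lrt z p0 p1 delta ->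
  \int[stop_law Q0 psi]_w (at_stop (bayes_cost p0 p1 z delta) w)%:E =
  \int[stop_law Q0 psi]_w (at_stop (optimal_cost p0 p1 z) w)%:E.
Proof.
move=> lrt; apply: ge0_ae_eq_integral => //.
- apply/measurable_EFinP; apply: measurable_at_stop.
  exact: (measurable_bayes_cost hp0 hp1).
- apply/measurable_EFinP; apply: measurable_at_stop.
  exact: (measurable_optimal_cost hp0 hp1).
- move=> w _; rewrite lee_fin at_stop_ge0// => t u.
  exact: (bayes_cost_ge0 hp0 hp1).
- move=> w _; rewrite lee_fin at_stop_ge0// => t u.
  exact: (optimal_cost_ge0 hp0 hp1).
apply: negligibleS (ae_stop_law_density_neq0 psi) => -[x o] /= + x0; apply.
case: o => [t|] //= _; congr EFin; apply/bayes_cost_eq_optimal; apply: lrt => i.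
by rewrite tnth_mktuple.
Qed.

Lemma le_integral_optimal_cost (psi delta : policy X R) :
  \int[stop_law Q0 psi]_w (at_stop (optimal_cost p0 p1 z) w)%:E <=
  \int[stop_law Q0 psi]_w (at_stop (bayes_cost p0 p1 z delta) w)%:E.
Proof.
apply: ge0_le_integral => //.
- move=> w _; rewrite lee_fin at_stop_ge0// => t u.
  exact: (optimal_cost_ge0 hp0 hp1).
- apply/measurable_EFinP; apply: measurable_at_stop.
  exact: (measurable_optimal_cost hp0 hp1).
- apply/measurable_EFinP; apply: measurable_at_stop.
  exact: (measurable_bayes_cost hp0 hp1).
- move=> -[x [t|]] _; rewrite lee_fin /at_stop //=.
  exact: optimal_cost_le_bayes.
Qed.

(** The minimum is at most 1 and the law is a probability; finiteness permits the cancellation in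
    the converse. *)
Lemma integral_optimal_cost_lty (psi : policy X R) :
  \int[stop_law Q0 psi]_w (at_stop (optimal_cost p0 p1 z) w)%:E < +oo.
Proof.
apply: (@le_lt_trans _ _ (\int[stop_law Q0 psi]_w cst 1 w)); last first.
  by rewrite integral_cst// mul1e (le_lt_trans (probability_le1 _ _)) ?ltry.
apply: ge0_le_integral => //.
- move=> w _; rewrite lee_fin at_stop_ge0// => t u.
  exact: (optimal_cost_ge0 hp0 hp1).
- apply/measurable_EFinP; apply: measurable_at_stop.
  exact: (measurable_optimal_cost hp0 hp1).
- move=> -[x [t|]] _; rewrite lee_fin /at_stop //=.
  exact: optimal_cost_le1.
Qed.

Lemma integral_bayes_cost_eq_ae_lrt (psi delta : policy X R) :
  \int[stop_law Q0 psi]_w (at_stop (bayes_cost p0 p1 z delta) w)%:E <=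
  \int[stop_law Q0 psi]_w (at_stop (optimal_cost p0 p1 z) w)%:E ->
  ae_lrt z p0 p1 Q0 psi delta.
Proof.
pose b := at_stop (bayes_cost p0 p1 z delta).
pose o := at_stop (optimal_cost p0 p1 z).
have mb : measurable_fun setT b.
  by apply: measurable_at_stop; exact: (measurable_bayes_cost hp0 hp1).
have mo : measurable_fun setT o.
  by apply: measurable_at_stop; exact: (measurable_optimal_cost hp0 hp1).
have o0 w : (0 <= o w)%R.
  by apply: at_stop_ge0 => t u; exact: (optimal_cost_ge0 hp0 hp1).
have ob w : (o w <= b w)%R.
  case: w => [x [t|]] //; rewrite /o /b /at_stop /=.
  exact: optimal_cost_le_bayes.
have mbo : measurable_fun setT (fun w => b w - o w)%R by exact: measurable_funB.
(* Additivity for nonnegative functions asks no integrability of [b]. The finite integral of [o]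
   then cancels, so the nonnegative excess [b - o] has integral 0 and vanishes almost everywhere. *)
have bE : \int[stop_law Q0 psi]_w (b w)%:E =
    \int[stop_law Q0 psi]_w (o w)%:E
    + \int[stop_law Q0 psi]_w (b w - o w)%:E.
  rewrite -ge0_integralD//.
  - by apply: eq_integral => w _; rewrite -EFinD subrKC.
  - by move=> w _; rewrite lee_fin.
  - exact/measurable_EFinP.
  - by move=> w _; rewrite lee_fin subr_ge0.
  - exact/measurable_EFinP.
rewrite -/b -/o bE => le_o.
have ofin : \int[stop_law Q0 psi]_w (o w)%:E \is a fin_num.
  rewrite ge0_fin_numE ?integral_optimal_cost_lty//.
  by apply: integral_ge0 => w _; rewrite lee_fin.
have bo0 : \int[stop_law Q0 psi]_w `|(b w - o w)%:E| = 0.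
  apply/eqP; rewrite eq_le integral_ge0// andbT.
  under eq_integral => w _ do rewrite gee0_abs ?lee_fin ?subr_ge0//.
  by move: le_o; rewrite -[leRHS]adde0 leeD2lE.
have mbo' : measurable_fun setT (fun w => (b w - o w)%:E).
  exact/measurable_EFinP.
have := (ae_eq_integral_abs _ measurableT mbo').1 bo0.
apply: negligibleS => w /= + bow; apply => t wt.
have [] := bow I; rewrite /b /o /at_stop wt => /eqP.
by rewrite subr_eq0 => /eqP/bayes_cost_eq_optimal + _.
Qed.

(** A non-randomized test is a witness: ties are decided as 0, and measurability comes from that of
    the likelihood ratio. *)
Lemma exists_lrt : exists delta : policy X R, is_lrt z p0 p1 delta.
Proof.
pose delta t (u : t.-tuple X) : R :=
  if (1 < z * likelihood_ratio p0 p1 u)%R then 1%R else 0%R.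
have mdelta t : measurable_fun [set: t.-tuple X] (@delta t).
  apply: measurable_fun_ifT => //; apply: measurable_fun_ltr => //.
  by apply: measurable_funM => //; exact: (measurable_likelihood_ratio hp0 hp1).
have delta01 t (u : t.-tuple X) : (0 <= delta t u <= 1)%R.
  by rewrite /delta; case: ifP; rewrite ?lexx ?ler01.
exists (Policy mdelta delta01) => t u _; split => //= zlr; rewrite /delta.
  by rewrite ltNge (ltW zlr).
by rewrite zlr.
Qed.

End optimality.

Theorem theorem3p2 (d : measure_display) (X : measurableType d) (R : realType)
    (mu : {measure set X -> \bar R}) (P0 P1 : probability X R)
    (p0 p1 : X -> R)
    (hp0 : is_density mu P0 p0) (hp1 : is_density mu P1 p1)
    (P1P0 : P1 `<< P0)
    (KL_neq0 : KL_divergence P0 p0 p1 != 0)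
    (KL_fin : KL_divergence P0 p0 p1 \is a fin_num)
    (Q0 Q1 : probability (seqspace X) R)
    (hQ0 : iid_law P0 Q0) (hQ1 : iid_law P1 Q1)
    (z c : R) (z_ge0 : (0 <= z)%R) (c_ge0 : (0 <= c)%R)
    (psi : policy X R) (hpsi : uniformly_bounded_stopping c psi) :
  [/\ exists delta : policy X R, is_lrt z p0 p1 delta,
      forall delta : policy X R, is_lrt z p0 p1 delta ->
        optimal_decision z Q0 Q1 psi delta /\
        weighted_error z Q0 Q1 psi delta = expected_truncated_lr z p0 p1 Q0 psi
    & forall delta : policy X R, optimal_decision z Q0 Q1 psi delta ->
        ae_lrt z p0 p1 Q0 psi delta].
Proof.
have WE := weighted_errorE hp0 hp1 P1P0 hQ0 hQ1 z_ge0 hpsi.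
split.
- exact: (exists_lrt hp0 hp1).
- move=> delta lrt; split.
    move=> delta'; rewrite !WE (integral_bayes_cost_lrt hp0 hp1 hQ0)//.
    exact: (le_integral_optimal_cost hp0 hp1).
  rewrite WE (integral_bayes_cost_lrt hp0 hp1 hQ0)//.
  by rewrite /expected_truncated_lr unlock.
- move=> delta opt; apply: (integral_bayes_cost_eq_ae_lrt hp0 hp1) => //.
  (* Some likelihood ratio test attains the integral of the minimum, so the cost of an optimal
     [delta] cannot exceed it. *)
  have [delta' lrt'] := exists_lrt hp0 hp1 z.
  rewrite -(integral_bayes_cost_lrt hp0 hp1 hQ0 z_ge0 psi lrt') -!WE.
  exact: opt.
Qed.
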